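(* Let $\mathcal{A}=(\mathcal{S}_1(\mathcal{H}),\boxtimes)$, where $\mathcal{H}=L^2(\mathbb{R}^\times,dt/|t|)$, and let $D:\mathcal{A}\to\mathcal{A}^*$ be the bounded linear map determined by $$D(\xi_1\otimes\eta_1)(\xi_0\otimes\eta_0)=\langle S\xi_1,R\overline{\xi_0}\rangle\,\langle R\overline{\eta_0},\eta_1\rangle .$$ Let $\top:\mathcal{A}^*\to\mathcal{A}^*$ be the transpose operator. Then $\top D:\mathcal{A}\to\mathcal{A}^*$ is completely bounded.
   Context: $\mathbb{R}^\times$ is the multiplicative group of non-zero reals with Haar measure $dt/|t|$; $\mathcal{H}=L^2(\mathbb{R}^\times,dt/|t|)$, with inner product linear in the first variable. $\overline{\mathcal{H}}$ is the conjugate Hilbert space; $\mathcal{H}\widehat{\otimes}\overline{\mathcal{H}}$ (projective tensor product) is identified with the trace-class operators $\mathcal{S}_1(\mathcal{H})$, with $\xi\otimes\eta$ corresponding to $\alpha\mapsto\langle\alpha,\eta\rangle\xi$. $\mathcal{A}$ is the Banach space $\mathcal{S}_1(\mathcal{H})$ equipped with the commutative Banach algebra product $\boxtimes$, the unique contractive bilinear map with $(\xi\otimes\eta)\boxtimes(\xi'\otimes\eta')=\int_{\mathbb{R}^\times}(\lambda(1+h)\xi\cdot\lambda(1+h^{-1})\xi')\otimes(\lambda(1+h)\eta\cdot\lambda(1+h^{-1})\eta')\,\frac{dh}{|h|}$, where $(\lambda(r)\xi)(t)=\xi(r^{-1}t)$ and $f\cdot g$ is the pointwise product. For $\xi\in\mathcal{H}$,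 $(S\xi)(t)=\operatorname{sgn}(t)\xi(t)$ with $\operatorname{sgn}(t)=t/|t|$, and $(R\xi)(t)=\xi(-t)$; $\overline{\xi}$ denotes the pointwise complex conjugate. The linear isometry $\top_*$ of $\mathcal{H}\widehat{\otimes}\overline{\mathcal{H}}$ is given by $\top_*(\xi\otimes\eta)=\overline{\eta}\otimes\overline{\xi}$, and $\top=(\top_* )^*$. Complete boundedness is with respect to the natural operator space structure on $\mathcal{S}_1(\mathcal{H})$ (as predual of $\mathcal{B}(\mathcal{H})$). Concretely: let $\mathcal{H}\otimes^2\mathcal{H}$ be the Hilbert space tensor product and let $s:\mathcal{S}_1(\mathcal{H})\widehat{\otimes}\mathcal{S}_1(\mathcal{H})\to\mathcal{S}_1(\mathcal{H}\otimes^2\mathcal{H})=(\mathcal{H}\otimes^2\mathcal{H})\widehat{\otimes}(\overline{\mathcal{H}}\otimes^2\overline{\mathcal{H}})$ be the injective map $\xi\otimes\eta\otimes\xi'\otimes\eta'\mapsto(\xi\otimes\xi')\otimes(\eta\otimes\eta')$. For $\Lambda\in(\mathcal{S}_1(\mathcal{H})\widehat{\otimes}\mathcal{S}_1(\mathcal{H}))^*$, the corresponding map $\mathcal{S}_1(\mathcal{H})\to\mathcal{S}_1(\mathcal{H})^*$, $T\mapsto\Lambda(T\otimes\,\cdot\,)$, is completely bounded if and only if $\Lambda\circ s^{-1}$ extends continuously to a bounded linear functional on $\mathcal{S}_1(\mathcal{H}\otimes^2\mathcal{H})$. *)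

(* Defs.v *)
From HB Require Import structures.
From mathcomp Require Import all_boot all_order all_algebra.
From mathcomp Require Import all_classical all_reals all_analysis.
From mathcomp Require Import measurable_realfun.
From mathcomp.real_closed Require Import complex.

Set Implicit Arguments.
Unset Strict Implicit.
Unset Printing Implicit Defensive.

Import Order.TTheory GRing.Theory Num.Def Num.Theory.
Import numFieldNormedType.Exports.

(* The complex numbers over R : realType are R[i]; ^* is their conjugation. *)
Local Notation Re := (@complex.Re _).
Local Notation Im := (@complex.Im _).

Local Open Scope classical_set_scope.
Local Open Scope ring_scope.
Local Open Scope complex_scope.
Local Open Scope quotient_scope.

Section CL2fun.
Context d (T : measurableType d) (R : realType).
Variable mu : {measure set T -> \bar R}.
Local Notation C := R[i].

(* L^p functions with complex values: f is measurable with |f|^p integrable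
   exactly when Re f and Im f are. *)
Definition CLfun (p : \bar R) : {pred T -> C} := fun f : T -> C =>
  ((Re \o f : T -> R) \in Lfun mu p) && ((Im \o f : T -> R) \in Lfun mu p).

Lemma CLfun_submod p : (1 <= p)%E -> submod_closed (CLfun p).
Proof.
move=> p1; have [l0 cl] := Lfun_submod_closed mu p1.
have clZ r h : h \in Lfun mu p -> r *: h \in Lfun mu p.
  by move=> h2; rewrite -[_ *: _]addr0; exact: cl.
split; first by apply/andP; split; exact: l0.
move=> a f g /andP[f1 f2] /andP[g1 g2]; apply/andP; split.
- have -> : Re \o (a *: f + g) =
    Re a *: (Re \o f : T -> R) + ((- Im a) *: (Im \o f) + (Re \o g)).
    apply/funext => t; rewrite !fctE /= /GRing.scale /=.
    by case: (f t) (g t) a => [x y] [z w] [r s] /=; rewrite addrA mulNr.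
  by apply: (cl) => //; apply: (cl).
- have -> : Im \o (a *: f + g) =
    Re a *: (Im \o f : T -> R) + (Im a *: (Re \o f) + (Im \o g)).
    apply/funext => t; rewrite !fctE /= /GRing.scale /=.
    by case: (f t) (g t) a => [x y] [z w] [r s] /=; rewrite addrA.
  by apply: (cl) => //; apply: (cl).
Qed.

HB.instance Definition _ := GRing.isSubmodClosed.Build C (T -> C) (CLfun 2%:E)
  (CLfun_submod (lee1n 2)).

(* L2 mu is the space of square-integrable functions T -> C modulo equality
   mu-almost everywhere. *)
Record L2fun := L2Fun { L2fun_fun :> T -> C; L2funP : L2fun_fun \in CLfun 2%:E }.
HB.instance Definition _ := [isSub for L2fun_fun].
HB.instance Definition _ := [Choice of L2fun by <:].
HB.instance Definition _ := [SubChoice_isSubLmodule of L2fun by <:].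

Definition L2null : {pred L2fun} := mem [set f : L2fun | \forall x \ae mu, f x = 0].

Lemma L2null_zmod : zmod_closed L2null.
Proof.
split; first by rewrite inE /=; exact: aeW.
move=> f g; rewrite !inE /= => f0 g0.
apply: filterS2 f0 g0 => x /= fx gx.
by rewrite -[LHS]/(f x - g x) fx gx subrr.
Qed.

HB.instance Definition _ := GRing.isZmodClosed.Build L2fun L2null L2null_zmod.

Definition L2 := Quotient.quot L2null.
HB.instance Definition _ := GRing.Zmodule.on L2.
HB.instance Definition _ := EqQuotient.on L2.
End CL2fun.

Section L2theory.
Context d (T : measurableType d) (R : realType).
Variable mu : {measure set T -> \bar R}.
Local Notation C := R[i].
Local Notation L2 := (L2 mu).
Local Notation L2fun := (L2fun mu).

Lemma L2_eqP (f g : L2fun) : \pi_L2 f = \pi_L2 g <-> \forall t \ae mu, f t = g t.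
Proof.
split=> [/eqmodP/=|fg].
  rewrite /Quotient.equiv inE /= => h; apply: filterS h => t h; apply: subr0_eq; exact: h.
apply/eqmodP; rewrite /= /Quotient.equiv inE /=; apply: filterS fg => t e.
by rewrite -[LHS]/(f t - g t) e subrr.
Qed.

Lemma repr_piE (f : L2fun) : \forall t \ae mu, repr (\pi_L2 f) t = f t.
Proof. by apply/L2_eqP; rewrite reprK. Qed.

Definition L2scale (a : C) (x : L2) : L2 := \pi_L2 (a *: repr x).

Lemma pi_scale a (f : L2fun) : \pi_L2 (a *: f) = L2scale a (\pi_L2 f).
Proof.
apply/L2_eqP; apply: filterS (repr_piE f) => t e.
by rewrite -[LHS]/(a * f t) -e.
Qed.

Lemma pi_add (f g : L2fun) : \pi_L2 (f + g) = \pi_L2 f + \pi_L2 g.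
Proof. exact: Quotient.pi_add. Qed.

Fact L2scaleA a b x : L2scale a (L2scale b x) = L2scale (a * b) x.
Proof. by elim/quotW: x => f; rewrite -(pi_scale b f) -!pi_scale scalerA. Qed.
Fact L2scale1 : left_id 1 L2scale.
Proof. by elim/quotW => f; rewrite -!pi_scale scale1r. Qed.
Fact L2scaleDr : right_distributive L2scale +%R.
Proof.
move=> a; elim/quotW => f; elim/quotW => g.
by rewrite -pi_add -!pi_scale -pi_add scalerDr.
Qed.
Fact L2scaleDl x : {morph L2scale^~ x : a b / a + b}.
Proof.
by move=> a b; elim/quotW: x => f; rewrite -!pi_scale -pi_add scalerDl.
Qed.

HB.instance Definition _ :=
  GRing.Zmodule_isLmodule.Build C L2 L2scaleA L2scale1 L2scaleDr L2scaleDl.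

End L2theory.

Section L2inner.
Context d (T : measurableType d) (R : realType).
Variable mu : {measure set T -> \bar R}.
Local Notation C := R[i].
Local Notation L2 := (L2 mu).
Local Notation L2fun := (L2fun mu).

Definition Cintegral (h : T -> C) : C :=
  (\int[mu]_t Re (h t))%R +i* (\int[mu]_t Im (h t))%R.

Lemma CintegralD (f g : T -> C) : f \in CLfun mu 1 -> g \in CLfun mu 1 ->
  Cintegral (fun t => f t + g t) = Cintegral f + Cintegral g.
Proof.
move=> /andP[/Lfun1_integrable f1 /Lfun1_integrable f2].
move=> /andP[/Lfun1_integrable g1 /Lfun1_integrable g2].
rewrite /Cintegral -[RHS]/((_ + _) +i* (_ + _)); congr (_ +i* _).
  by rewrite -RintegralD//; apply: eq_Rintegral => t _; case: (f t) (g t) => ? ? [].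
by rewrite -RintegralD//; apply: eq_Rintegral => t _; case: (f t) (g t) => ? ? [].
Qed.

Lemma CintegralZ (a : C) (f : T -> C) : f \in CLfun mu 1 ->
  Cintegral (fun t => a * f t) = a * Cintegral f.
Proof.
move=> /andP[/Lfun1_integrable f1 /Lfun1_integrable f2].
have fZ (r : R) (h : T -> R) : mu.-integrable setT (EFin \o h) ->
    mu.-integrable setT (EFin \o (fun t => r * h t)).
  by move=> hi; under [X in _.-integrable _ X]eq_fun do rewrite /= EFinM; exact: integrableZl.
case: a => r s; rewrite /Cintegral -[RHS]/((_ - _) +i* (_ + _)); congr (_ +i* _).
  rewrite -!RintegralZl// -RintegralB//; [|exact: fZ|exact: fZ].
  by apply: eq_Rintegral => t _; case: (f t).
rewrite -!RintegralZl// -RintegralD//; [|exact: fZ|exact: fZ].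
by apply: eq_Rintegral => t _; case: (f t).
Qed.

Lemma Cintegral_conj (f : T -> C) : f \in CLfun mu 1 ->
  Cintegral (fun t => (f t)^*) = (Cintegral f)^*.
Proof.
move=> /andP[/Lfun1_integrable f1 /Lfun1_integrable f2].
rewrite /Cintegral -[RHS]/(_ +i* - _); congr (_ +i* _).
  by apply: eq_Rintegral => t _; case: (f t).
rewrite -mulN1r -RintegralZl//; apply: eq_Rintegral => t _.
by case: (f t) => x y /=; rewrite mulN1r.
Qed.

Lemma CLfun_mulC (f g : L2fun) : (fun t => f t * (g t)^*) \in CLfun mu 1.
Proof.
have l11 : (1 <= 1 :> \bar R)%E by [].
have [/andP[f1 f2] /andP[g1 g2]] := (L2funP f, L2funP g).
have [l0 cl] := Lfun_submod_closed mu l11.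
have pr := Lfun2_mul_Lfun1.
apply/andP; split.
  rewrite (_ : _ \o _ = 1 *: ((Re \o f) \* (Re \o g) : T -> R) +
      (1 *: ((Im \o f) \* (Im \o g) : T -> R) + 0)).
    apply: (cl); first exact: pr.
    by apply: (cl) => //; exact: pr.
  apply/funext => t; rewrite addr0 !scale1r !fctE /=.
  by case: (f t) (g t) => [x y] [z w] /=; rewrite mulrN opprK.
rewrite (_ : _ \o _ = (- 1) *: ((Re \o f) \* (Im \o g) : T -> R) +
    (1 *: ((Im \o f) \* (Re \o g) : T -> R) + 0)).
  apply: (cl); first exact: pr.
  by apply: (cl) => //; exact: pr.
apply/funext => t; rewrite addr0 scale1r scaleN1r !fctE /=.
by case: (f t) (g t) => [x y] [z w] /=; rewrite mulrN.
Qed.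

Lemma measurable_CLfun (p : \bar R) (f : T -> C) : f \in CLfun mu p ->
  measurable_fun setT (Re \o f) /\ measurable_fun setT (Im \o f).
Proof. by move=> /andP[/sub_Lfun_mfun/[!inE]/= ? /sub_Lfun_mfun/[!inE]/= ?]. Qed.

Lemma ae_eq_Cintegral (f g : T -> C) : f \in CLfun mu 1 -> g \in CLfun mu 1 ->
  (\forall t \ae mu, f t = g t) -> Cintegral f = Cintegral g.
Proof.
move=> /measurable_CLfun[f1 f2] /measurable_CLfun[g1 g2] fg.
rewrite /Cintegral; congr (_ +i* _); congr fine; apply: ae_eq_integral => //.
- exact/measurable_EFinP.
- exact/measurable_EFinP.
- by apply: filterS fg => t e _; rewrite e.
- exact/measurable_EFinP.
- exact/measurable_EFinP.
- by apply: filterS fg => t e _; rewrite e.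
Qed.

(* Linear in the first variable. *)
Definition L2inner (x y : L2) : C := Cintegral (fun t => repr x t * (repr y t)^*).

Lemma L2innerE (f g : L2fun) :
  L2inner (\pi_L2 f) (\pi_L2 g) = Cintegral (fun t => f t * (g t)^*).
Proof.
apply: ae_eq_Cintegral; [exact: CLfun_mulC|exact: CLfun_mulC|].
by apply: filterS2 (repr_piE f) (repr_piE g) => t -> ->.
Qed.

Fact L2inner_linearl y : linear_for *%R (L2inner ^~ y).
Proof.
move=> a; elim/quotW => f; elim/quotW => g; elim/quotW: y => h.
have -> : a *: \pi_L2 f + \pi_L2 g = \pi_L2 (a *: f + g).
  by rewrite pi_add pi_scale.
rewrite !L2innerE -CintegralZ ?CLfun_mulC// -CintegralD ?CLfun_mulC//; last first.
  rewrite (_ : (fun _ => _) = (fun t => (a *: f) t * (h t)^*)) ?CLfun_mulC//.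
  by apply/funext => t; rewrite mulrA.
by congr Cintegral; apply/funext => t; rewrite mulrA -mulrDl.
Qed.

Fact L2inner_herm x y : L2inner x y = (-1) ^+ false * conjC (L2inner y x).
Proof.
rewrite expr0 mul1r; elim/quotW: x => f; elim/quotW: y => g.
rewrite !L2innerE -[RHS]/((Cintegral _)^*) -Cintegral_conj ?CLfun_mulC//.
by congr Cintegral; apply/funext => t; rewrite rmorphM /= conjcK mulrC.
Qed.

Fact L2inner_linearr x : linear_for (conjC \; *%R) (L2inner x).
Proof.
move=> a y z; rewrite L2inner_herm L2inner_linearl !expr0 !mul1r.
by rewrite rmorphD rmorphM /= (L2inner_herm x y) (L2inner_herm x z) !expr0 !mul1r.
Qed.

HB.instance Definition _ :=
  bilinear_isBilinear.Build C L2 L2 C *%R (conjC \; *%R) L2inner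
    (L2inner_linearl, L2inner_linearr).
HB.instance Definition _ :=
  isHermitianSesquilinear.Build C L2 false conjC L2inner L2inner_herm.

Fact L2inner_gt0 x : x != 0 -> 0 < L2inner x x.
Proof.
elim/quotW: x => f f0; rewrite L2innerE.
pose h t := Re (f t) ^+ 2 + Im (f t) ^+ 2.
have h0 t : 0 <= h t by rewrite addr_ge0 ?sqr_ge0.
have ih := CLfun_mulC f f.
have -> : Cintegral (fun t => f t * (f t)^*) = (\int[mu]_t h t)%:C.
  rewrite /Cintegral -[RHS]/(_ +i* 0); congr (_ +i* _).
    by apply: eq_Rintegral => t _; rewrite /h; case: (f t) => x y /=; rewrite mulrN opprK.
  rewrite (_ : (fun _ => _) = cst 0) ?/Rintegral ?integral0//.
  by apply/funext => t; case: (f t) => x y /=; rewrite mulrN mulrC addNr.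
rewrite ltcR lt_neqAle Rintegral_ge0// andbT.
apply: contra f0 => /eqP/esym e.
have {}ih : mu.-integrable setT (EFin \o h).
  move: ih => /andP[/Lfun1_integrable + _]; apply: eq_integrable => // t _.
  by rewrite /h /=; case: (f t) => x y /=; rewrite mulrN opprK.
have {}e : (\int[mu]_t `|(h t)%:E| = 0)%E.
  move: e; rewrite /Rintegral => e.
  rewrite -[RHS]/(0%:E) -e fineK ?integrable_fin_num//.
  by apply: eq_integral => t _; rewrite gee0_abs// lee_fin.
have mh : measurable_fun setT (EFin \o h) by exact: measurable_int ih.
have [+ _] := ae_eq_integral_abs mu measurableT mh => /(_ e) hae.
apply/eqP; rewrite -[RHS](@pi_zeror _ _ _ _ _ L2).
apply/L2_eqP; apply: filterS hae => t /(_ I)[] /eqP.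
rewrite /h paddr_eq0 ?sqr_ge0// !sqrf_eq0 => /andP[/eqP r /eqP i].
by move: r i; case: (f t) => x y /= -> ->.
Qed.
HB.instance Definition _ := isDotProduct.Build C L2 L2inner L2inner_gt0.

End L2inner.

Section L2norm.
Context d (T : measurableType d) (R : realType).
Variable mu : {measure set T -> \bar R}.
Local Notation C := R[i].
Local Notation L2 := (L2 mu).
Local Notation "''[' u , v ]" := (@L2inner d T R mu u v) : ring_scope.
Local Notation dotL2 := (@L2inner d T R mu : {dot L2 for conjC}).
Implicit Types u v : L2.

Definition L2norm u : C := sqrtC '[u, u].

Lemma L2norm_ge0 u : 0 <= L2norm u.
Proof. exact: (sqrt_dnorm_ge0 dotL2). Qed.

Lemma L2normK u : L2norm u ^+ 2 = '[u, u].
Proof. exact: sqrtCK. Qed.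

Lemma L2CauchySchwarz u v : `|'[u, v]| <= L2norm u * L2norm v.
Proof.
rewrite -ler_sqr ?nnegrE ?mulr_ge0 ?L2norm_ge0// exprMn !L2normK.
have [->|v0] := eqVneq v 0.
  by rewrite (linear0r dotL2) normr0 expr0n (linear0l dotL2) mulr0.
pose a := '[u, v] / '[v, v]; pose w := u - a *: v.
have vn0 : '[v, v] != 0 by rewrite (dnorm_eq0 dotL2).
have ow : '[w, v] = 0.
  by rewrite (linearBl dotL2) (linearZl_LR dotL2) /= divfK// subrr.
have ow' : '[w, a *: v] = 0 by rewrite (linearZr_LR dotL2) /= ow mulr0.
have -> : u = w + a *: v by rewrite subrK.
have -> : '[w + a *: v, v] = a * '[v, v].
  by rewrite (linearDl dotL2) /= ow add0r (linearZl_LR dotL2).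
have -> : '[w + a *: v, w + a *: v] = '[w, w] + `|a| ^+ 2 * '[v, v].
  by rewrite -(dnormZ dotL2) -(hnormDd (form := dotL2) ow').
rewrite mulrDl.
rewrite normrM exprMn (ger0_norm (dnorm_ge0 dotL2 v)) expr2 mulrA lerDr.
by rewrite mulr_ge0 ?(dnorm_ge0 dotL2).
Qed.

Lemma L2normD u v : L2norm (u + v) <= L2norm u + L2norm v.
Proof.
rewrite -ler_sqr ?nnegrE ?addr_ge0 ?L2norm_ge0// L2normK (dnormD dotL2).
rewrite sqrrD !L2normK [leRHS]addrAC lerD2l.
have -> : '[u, v] + ('[u, v])^* = ('Re '[u, v]) *+ 2.
  by rewrite ReE -[RHS]mulr_natr divfK// pnatr_eq0.
rewrite lerMn2r /=; apply: (le_trans _ (L2CauchySchwarz u v)).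
by rewrite leif_Re_Creal.
Qed.

Lemma L2normZ a u : L2norm (a *: u) = `|a| * L2norm u.
Proof.
by rewrite /L2norm (dnormZ dotL2) sqrtCM ?nnegrE ?exprn_ge0 ?(dnorm_ge0 dotL2)// sqrCK.
Qed.

Lemma L2norm_eq0 u : L2norm u = 0 -> u = 0.
Proof. by move/eqP; rewrite (sqrt_dnorm_eq0 dotL2) => /eqP. Qed.

HB.instance Definition _ :=
  Lmodule_isNormed.Build C L2 L2normD L2normZ L2norm_eq0.
End L2norm.

(* Norms of normed C-modules are C-valued in the library; rnorm is the same norm
   as a real number. *)
Definition rnorm (R : realType) (V : normedModType R[i]) (x : V) : R := Re `|x|.

Section rnorm.
Context (R : realType) (V : normedModType R[i]).
Implicit Types x y : V.

Lemma rnormE x : `|x| = (rnorm x)%:C.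
Proof.
by rewrite /rnorm; have := normr_ge0 x; case: `|x| => a b; rewrite lecE /= => /andP[/eqP -> _].
Qed.

Lemma rnorm_ge0 x : 0 <= rnorm x.
Proof. by rewrite -lecR -rnormE; exact: normr_ge0. Qed.

Lemma rnormZ a x : rnorm (a *: x) = rnorm (a : R[i]^o) * rnorm x.
Proof. by apply: complexI; rewrite rmorphM /= -!rnormE normrZ. Qed.

Lemma rnormD x y : rnorm (x + y) <= rnorm x + rnorm y.
Proof. by rewrite -lecR rmorphD /= -!rnormE ler_normD. Qed.

Lemma rnorm0_eq0 x : rnorm x = 0 -> x = 0.
Proof. by move=> x0; apply/normr0_eq0; rewrite rnormE x0. Qed.

Lemma rnorm0 : rnorm (0 : V) = 0.
Proof. by apply: complexI; rewrite -rnormE normr0. Qed.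
End rnorm.

Section interleave.
Definition interleave (X : Type) (f g : nat -> X) (n : nat) : X :=
  if odd n then g n./2 else f n./2.

Lemma sum_interleave (V : nmodType) (f g : nat -> V) n :
  \sum_(0 <= k < n) interleave f g k =
  \sum_(0 <= k < uphalf n) f k + \sum_(0 <= k < n./2) g k.
Proof.
elim: n => [|n IH]; first by rewrite !big_geq ?addr0.
rewrite big_nat_recr//= IH /interleave uphalf_half.
case: (odd n) => /=; first by rewrite add1n [X in _ = _ + X]big_nat_recr//= addrA.
by rewrite add0n [X in _ = X + _]big_nat_recr//= addrAC.
Qed.

Lemma interleave_map (X Y Z : Type) (h : X -> Y -> Z) f f' g g' n :
  h (interleave f g n) (interleave f' g' n) =
  interleave (fun k => h (f k) (f' k)) (fun k => h (g k) (g' k)) n.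
Proof. by rewrite /interleave; case: odd. Qed.

Lemma cvg_half : half @ \oo --> \oo.
Proof.
move=> A [N _ NA]; exists N.*2 => // n /= Nn; apply: NA => /=.
by rewrite -(doubleK N) half_leq.
Qed.

Lemma cvg_uphalf : uphalf @ \oo --> \oo.
Proof.
move=> A [N _ NA]; exists N.*2 => // n /= Nn; apply: NA => /=.
by rewrite -(doubleK N) (leq_trans (half_leq Nn))// uphalf_half leq_addl.
Qed.

Lemma cvg_interleave (K : numFieldType) (V : normedModType K) (f g : nat -> V) a b :
  series f @ \oo --> a -> series g @ \oo --> b ->
  series (interleave f g) @ \oo --> a + b.
Proof.
move=> fa gb; rewrite (_ : series _ = (series f \o uphalf) \+ (series g \o half)).
  apply: cvgD; [exact: cvg_comp cvg_uphalf fa|exact: cvg_comp cvg_half gb].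
by apply/funext => n; rewrite /series/= sum_interleave.
Qed.
End interleave.

Section nuclear.
Context d (T : measurableType d) (R : realType).
Variable mu : {measure set T -> \bar R}.
Local Notation C := R[i].
Local Notation H := (L2 mu).
Local Notation "''[' u , v ]" := (@L2inner d T R mu u v) : ring_scope.

(* A = \sum_n u_n (x) v_n, where (u (x) v) x = <x, v> u. *)
Definition nuclear_sum (u v : nat -> H) (A : H -> H) :=
  forall x, series (fun n => '[x, v n] *: u n) @ \oo --> A x.

Definition nuclear_cost (u v : nat -> H) : \bar R :=
  (\sum_(0 <= n <oo) (rnorm (u n) * rnorm (v n))%:E)%E.

(* The projective tensor product of H and its conjugate space, realized as the
   trace-class operators: the operators of the form \sum_n u_n (x) v_n with
   \sum_n |u_n| |v_n| < oo. *)
Definition nuclear : {pred H -> H} := mem [set A : H -> H |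
  exists u v, nuclear_sum u v A /\ (nuclear_cost u v < +oo)%E].

Lemma cost_ge0 u v : (0 <= nuclear_cost u v)%E.
Proof. by apply: nneseries_ge0 => n _ _; rewrite lee_fin mulr_ge0 ?rnorm_ge0. Qed.

Lemma cost_lb u v n : ((\sum_(0 <= k < n) (rnorm (u k) * rnorm (v k)))%:E
   <= nuclear_cost u v)%E.
Proof.
rewrite -sumEFin; apply: nneseries_lim_ge => k _.
by rewrite lee_fin mulr_ge0 ?rnorm_ge0.
Qed.

Lemma cost_ub u v c : (forall n, \sum_(0 <= k < n) (rnorm (u k) * rnorm (v k)) <= c) ->
  (nuclear_cost u v <= c%:E)%E.
Proof.
move=> h; apply: lime_le.
  by apply: is_cvg_nneseries => n _ _; rewrite lee_fin mulr_ge0 ?rnorm_ge0.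
by apply: nearW => n; rewrite sumEFin lee_fin.
Qed.

Lemma cost_interleave u v u' v' :
  (nuclear_cost (interleave u u') (interleave v v') <=
   nuclear_cost u v + nuclear_cost u' v')%E.
Proof.
have [->|] := eqVneq (nuclear_cost u v) +oo%E.
  by rewrite addye ?leey// gt_eqF// (lt_le_trans _ (cost_ge0 _ _))// ltNyr.
rewrite -ltey => h.
have [->|] := eqVneq (nuclear_cost u' v') +oo%E.
  by rewrite addey ?leey// gt_eqF// (lt_le_trans _ (cost_ge0 _ _))// ltNyr.
rewrite -ltey => h'.
have /fineK <- : nuclear_cost u v \is a fin_num by rewrite ge0_fin_numE ?cost_ge0.
have /fineK <- : nuclear_cost u' v' \is a fin_num by rewrite ge0_fin_numE ?cost_ge0.
rewrite -EFinD; apply: cost_ub => n.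
under eq_bigr do rewrite (interleave_map (fun x y => rnorm x * rnorm y)).
rewrite sum_interleave lerD// -lee_fin fineK ?cost_lb// ge0_fin_numE ?cost_ge0//.
Qed.

Definition nuclear_rep (A : H -> H) (s : R) :=
  exists u v, nuclear_sum u v A /\ nuclear_cost u v = s%:E.

Lemma nuclear_repP u v A (s : R) :
  nuclear_sum u v A -> (nuclear_cost u v <= s%:E)%E ->
  exists2 s', s' <= s & nuclear_rep A s'.
Proof.
move=> uvA; have := cost_ge0 u v; case E : nuclear_cost => [s'| |]//= _.
by rewrite lee_fin => s's; exists s' => //; exists u, v.
Qed.

Lemma nuclear_rep_ge0 A s : nuclear_rep A s -> 0 <= s.
Proof. by move=> [u [v [_ e]]]; rewrite -lee_fin -e cost_ge0. Qed.

Lemma nuclearP (A : H -> H) : A \in nuclear <-> exists s, nuclear_rep A s.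
Proof.
rewrite inE /=; split=> [[u [v [uvA uvf]]]|[s [u [v [uvA e]]]]].
  exists (fine (nuclear_cost u v)), u, v; split => //.
  by rewrite fineK// ge0_fin_numE ?cost_ge0.
by exists u, v; rewrite e ltey.
Qed.

Lemma nuclear_rep0 : nuclear_rep 0 0.
Proof.
have [||s s0 r] := @nuclear_repP (fun=> 0) (fun=> 0) 0 0.
- move=> x; under [X in series X]eq_fun do rewrite scaler0.
  by rewrite /series /=; under eq_fun do rewrite big1//; exact: cvg_cst.
- by apply: cost_ub => n; rewrite big1// => k _; rewrite rnorm0 mulr0.
- by rewrite (_ : 0 = s)//; apply/le_anti; rewrite s0 (nuclear_rep_ge0 r).
Qed.

Lemma nuclear_repD A B s t : nuclear_rep A s -> nuclear_rep B t ->
  exists2 r, r <= s + t & nuclear_rep (A + B) r.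
Proof.
move=> [u [v [uvA e]]] [u' [v' [uvB e']]].
apply: (@nuclear_repP (interleave u u') (interleave v v')).
  move=> x; under [X in series X]eq_fun do
    rewrite (interleave_map (fun p q => '[x, q] *: p)).
  by apply: cvg_interleave; [exact: uvA|exact: uvB].
by apply: (le_trans (cost_interleave _ _ _ _)); rewrite e e' EFinD.
Qed.

Lemma nuclear_repZ a A s : nuclear_rep A s ->
  exists2 r, r <= rnorm (a : C^o) * s & nuclear_rep (a *: A) r.
Proof.
move=> [u [v [uvA e]]]; apply: (@nuclear_repP (fun n => a *: u n) v).
  move=> x; under [X in series X]eq_fun do rewrite scalerA mulrC -scalerA.
  rewrite (_ : series _ = (fun n => a *: series (fun n => '[x, v n] *: u n) n)).
    by apply: cvgZl_tmp; exact: uvA.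
  by apply/funext => n; rewrite /series /= scaler_sumr.
apply: cost_ub => n; under eq_bigr do rewrite rnormZ -mulrA.
by rewrite -mulr_sumr ler_wpM2l ?rnorm_ge0// -lee_fin -e cost_lb.
Qed.

Lemma nuclear_rep_bound A s x : nuclear_rep A s -> rnorm (A x) <= s * rnorm x.
Proof.
move=> [u [v [uvA e]]]; rewrite leNgt; apply/negP.
rewrite -ltcR -rnormE => /(cvgr_norm_gt _ (uvA x)) [N _] /(_ N (leqnn N)).
rewrite /= rnormE ltcR; apply/negP; rewrite -leNgt /series /=.
apply: (@le_trans _ _ (\sum_(0 <= k < N) (rnorm (u k) * rnorm (v k)) * rnorm x)).
  elim: N => [|n IH]; first by rewrite !big_geq// rnorm0.
  rewrite !big_nat_recr//=; apply: (le_trans (rnormD _ _)); rewrite lerD//.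
  rewrite rnormZ mulrC -mulrA ler_wpM2l ?rnorm_ge0//.
  rewrite [leRHS]mulrC.
  have := L2CauchySchwarz x (v n).
  rewrite -[L2norm x]/(`|x|) -[L2norm (v n)]/(`|v n|) !rnormE -rmorphM.
  by rewrite -[`|L2inner x (v n)|]/(`|L2inner x (v n) : C^o|) rnormE lecR mulrC.
by rewrite -mulr_suml ler_wpM2r ?rnorm_ge0// -lee_fin -e cost_lb.
Qed.

Lemma nuclear_submod : submod_closed nuclear.
Proof.
split; first by apply/nuclearP; exists 0; exact: nuclear_rep0.
move=> a A B /nuclearP[s rA] /nuclearP[t rB]; apply/nuclearP.
have [s' _ rA'] := nuclear_repZ a rA.
by have [r _ ?] := nuclear_repD rA' rB; exists r.
Qed.

HB.instance Definition _ :=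
  GRing.isSubmodClosed.Build C (H -> H) nuclear nuclear_submod.

Record S1 := TraceClass { S1_fun :> H -> H; S1P : S1_fun \in nuclear }.
HB.instance Definition _ := [isSub for S1_fun].
HB.instance Definition _ := [Choice of S1 by <:].
HB.instance Definition _ := [SubChoice_isSubLmodule of S1 by <:].

(* The projective tensor norm, i.e. the trace norm: the infimum of
   \sum_n |u_n| |v_n| over all such decompositions of A. *)
Definition trace_norm (A : S1) : R := inf [set s | nuclear_rep A s].

Lemma has_inf_rep (A : S1) : has_inf [set s | nuclear_rep A s].
Proof.
split; first by have /nuclearP[s] := S1P A; exists s.
by exists 0 => s /nuclear_rep_ge0.
Qed.

Lemma trace_norm_le (A : S1) s : nuclear_rep A s -> trace_norm A <= s.
Proof. by move=> r; apply: ge_inf => //; have [] := has_inf_rep A. Qed.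

Lemma trace_norm_ge (A : S1) c :
  (forall s, nuclear_rep A s -> c <= s) -> c <= trace_norm A.
Proof. by move=> h; apply: lb_le_inf; [have [] := has_inf_rep A|]. Qed.

Lemma trace_norm_ge0 (A : S1) : 0 <= trace_norm A.
Proof. by apply: trace_norm_ge => s /nuclear_rep_ge0. Qed.

Lemma trace_normD (A B : S1) : trace_norm (A + B) <= trace_norm A + trace_norm B.
Proof.
rewrite -lerBlDr; apply: trace_norm_ge => s rA.
rewrite lerBlDr -lerBlDl; apply: trace_norm_ge => t rB; rewrite lerBlDl.
by have [r rst rAB] := nuclear_repD rA rB; rewrite (le_trans _ rst)// trace_norm_le.
Qed.

Lemma trace_normZ_le a (A : S1) :
  trace_norm (a *: A) <= rnorm (a : C^o) * trace_norm A.
Proof.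
have [->|a0] := eqVneq a 0.
  by rewrite rnorm0 mul0r scale0r trace_norm_le//; exact: nuclear_rep0.
have n0 : 0 < rnorm (a : C^o).
  by rewrite lt_def rnorm_ge0 andbT; apply: contra a0 => /eqP/rnorm0_eq0 ->.
rewrite mulrC -ler_pdivrMr//; apply: trace_norm_ge => s rA.
rewrite ler_pdivrMr// mulrC; have [t ts rt] := nuclear_repZ a rA.
by rewrite (le_trans _ ts)// trace_norm_le.
Qed.

Lemma trace_normZ a (A : S1) : trace_norm (a *: A) = rnorm (a : C^o) * trace_norm A.
Proof.
apply/le_anti; rewrite trace_normZ_le /=.
have [->|a0] := eqVneq a 0; first by rewrite rnorm0 mul0r trace_norm_ge0.
have n0 : 0 < rnorm (a : C^o).
  by rewrite lt_def rnorm_ge0 andbT; apply: contra a0 => /eqP/rnorm0_eq0 ->.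
rewrite mulrC -ler_pdivlMr//; have := trace_normZ_le a^-1 (a *: A).
rewrite scalerA mulVf// scale1r mulrC (_ : rnorm _ = (rnorm (a : C^o))^-1)//.
by apply: complexI; rewrite fmorphV /= -!rnormE normfV.
Qed.

Lemma trace_norm_eq0 (A : S1) : trace_norm A = 0 -> A = 0.
Proof.
move=> A0; apply/val_inj/funext => x /=; apply: rnorm0_eq0.
apply/le_anti; rewrite rnorm_ge0 andbT.
have [x0|x0] := eqVneq (rnorm x) 0.
  by have /nuclearP[s /(nuclear_rep_bound x)] := S1P A; rewrite x0 mulr0.
have {}x0 : 0 < rnorm x by rewrite lt_def x0 rnorm_ge0.
rewrite -[leRHS](mul0r (rnorm x)) -ler_pdivrMr// -A0.
by apply: trace_norm_ge => s r; rewrite ler_pdivrMr//; exact: nuclear_rep_bound.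
Qed.

Definition S1norm (A : S1) : C := (trace_norm A)%:C.

Fact S1normD A B : S1norm (A + B) <= S1norm A + S1norm B.
Proof. by rewrite -rmorphD lecR trace_normD. Qed.
Fact S1normZ a A : S1norm (a *: A) = `|a| * S1norm A.
Proof. by rewrite /S1norm trace_normZ rmorphM -[`|a|]/(`|a : C^o|) rnormE. Qed.
Fact S1norm_eq0 A : S1norm A = 0 -> A = 0.
Proof. by move=> /complexI/trace_norm_eq0. Qed.

HB.instance Definition _ := Lmodule_isNormed.Build C S1 S1normD S1normZ S1norm_eq0.

(* The elementary tensor x (x) y. *)
Definition tensor_fun (x y : H) : H -> H := fun z => '[z, y] *: x.

Fact tensor_subproof x y : tensor_fun x y \in nuclear.
Proof.
rewrite inE /=; exists (fun n => if n is 0%N then x else 0).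
exists (fun n => if n is 0%N then y else 0).
split.
  move=> z; apply: cvg_near_cst; exists 1%N => // -[//|n] _ /=.
  rewrite /series /= big_nat_recl//= big1 ?addr0// => k _; exact: scaler0.
apply: (@le_lt_trans _ _ (rnorm x * rnorm y)%:E); last exact: ltey.
apply: cost_ub => -[|n]; first by rewrite big_geq ?mulr_ge0 ?rnorm_ge0.
by rewrite big_nat_recl//= big1 ?addr0// => k _; rewrite rnorm0 mulr0.
Qed.
Definition tensor x y : S1 := TraceClass (tensor_subproof x y).
End nuclear.

Section haar.
Context (R : realType).
Local Notation leb := (@lebesgue_measure R).
Local Notation C := R[i].

(* The Haar measure dt/|t| of the multiplicative group of non-zero reals, as a
   measure on R. Since {0} is a null set, L2 haar_measure is the L^2 space of that
   group: values at 0 are irrelevant. *)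
Definition haar_density (t : R) : \bar R := (`|t|^-1)%:E.

Lemma measurable_haar_density : measurable_fun [set: measurableTypeR R] haar_density.
Proof.
apply/measurable_EFinP; rewrite -(setUv [set 0 : R]).
have e : ~` [set 0] = [set t : R | t != 0] by apply/seteqP; split=> t /= /eqP.
apply/measurable_funU; [by []|exact: measurableC|split].
  exact: measurable_fun_set1.
apply: open_continuous_measurable_fun; first by rewrite e; exact: open_neq.
move=> t; rewrite e inE /= => t0; apply: cvgV; first by rewrite normr_eq0.
exact: norm_continuous.
Qed.

Definition haar_measure (A : set (measurableTypeR R)) : \bar R :=
  (\int[leb]_(t in A) haar_density t)%E.

Let haar0 : haar_measure set0 = 0%E.
Proof. exact: integral_set0. Qed.
Let haar_ge0 A : (0 <= haar_measure A)%E.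
Proof. by apply: integral_ge0 => t _; rewrite lee_fin invr_ge0. Qed.
Let haar_sigma_additive : semi_sigma_additive haar_measure.
Proof.
move=> F mF tF mUF; rewrite /haar_measure ge0_integral_bigcup//.
- by apply: is_cvg_nneseries => n _ _; exact: haar_ge0.
- by apply: measurable_funTS; exact: measurable_haar_density.
- by move=> t _; rewrite lee_fin invr_ge0.
Qed.

HB.instance Definition _ := isMeasure.Build _ _ _ haar_measure
  haar0 haar_ge0 haar_sigma_additive.

Lemma haarN (A : set (measurableTypeR R)) : measurable A ->
  haar_measure (-%R @^-1` A) = haar_measure A.
Proof.
move=> mA; rewrite /haar_measure.
have mN : measurable_fun setT (-%R : measurableTypeR R -> measurableTypeR R) by [].
have mh := measurable_funTS (D := A) measurable_haar_density.
have h0 : {in A, forall t, 0 <= haar_density t}%E.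
  by move=> t _; rewrite lee_fin invr_ge0.
have e := ge0_integral_pushforward mN leb mA mh h0.
transitivity (\int[pushforward leb (-%R : measurableTypeR R ->
  measurableTypeR R)]_(y in A) haar_density y)%E.
  by rewrite e; apply: eq_integral => t _; rewrite /haar_density /= normrN.
by apply: eq_measure_integral => B mB _; exact: lebesgue_measureN.
Qed.

End haar.

Section Lfun2.
Context d (T : measurableType d) (R : realType) (mu : {measure set T -> \bar R}).

Lemma Lfun2P (h : T -> R) : h \in Lfun mu 2%:E <->
  measurable_fun setT h /\ (\int[mu]_t (h t ^+ 2)%:E < +oo)%E.
Proof.
split=> [h2|[mh h2]].
  split; first by have /sub_Lfun_mfun/[!inE] := h2.
  have /integrableP[_] := Lfun2_integrable_sqr h2; apply: le_lt_trans.
  rewrite le_eqVlt; apply/orP; left; apply/eqP/eq_integral => t _.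
  by rewrite /= ger0_norm ?sqr_ge0.
rewrite inE; apply/andP; split; first by rewrite inE.
rewrite !inE/= /finite_norm unlock /Lnorm poweR_lty//.
apply: le_lt_trans h2; rewrite le_eqVlt; apply/orP; left; apply/eqP/eq_integral => t _.
by rewrite /= powR_mulrn// real_normK// num_real.
Qed.
End Lfun2.

Section conjugation.
Context d (T : measurableType d) (R : realType) (mu : {measure set T -> \bar R}).
Local Notation C := R[i].
Local Notation H := (L2 mu).

Fact L2conj_subproof (f : L2fun mu) : (fun t => (f t)^*) \in CLfun mu 2%:E.
Proof.
have /andP[f1 f2] := L2funP f; apply/andP; split.
  by rewrite (_ : _ \o _ = Re \o f)//; apply/funext => t /=; case: (f t).
rewrite (_ : _ \o _ = - (Im \o f)).
  exact: Lfun_oppr_closed.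
by apply/funext => t /=; rewrite !fctE /=; case: (f t).
Qed.

Definition L2conj (x : H) : H := \pi_(L2 mu) (L2Fun (L2conj_subproof (repr x))).

Lemma L2conjE (f : L2fun mu) :
  L2conj (\pi_(L2 mu) f) = \pi_(L2 mu) (L2Fun (L2conj_subproof f)).
Proof. by apply/L2_eqP; apply: filterS (repr_piE f) => t /= ->. Qed.
End conjugation.

Section SR.
Context (R : realType).
Local Notation C := R[i].
Local Notation haar_measure := (@haar_measure R).
Local Notation H := (L2 haar_measure).

Lemma haar_int_opp (h : R -> \bar R) : measurable_fun setT h ->
  (forall t, 0 <= h t)%E -> (\int[haar_measure]_t h (- t)%R = \int[haar_measure]_t h t)%E.
Proof.
move=> mh h0.
have mN : measurable_fun setT (-%R : measurableTypeR R -> measurableTypeR R) by [].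
have h0' : {in [set: measurableTypeR R], forall t, 0 <= h t}%E by move=> t _.
rewrite -[LHS](ge0_integral_pushforward mN haar_measure measurableT mh h0').
by apply: eq_measure_integral => B mB _; exact: haarN.
Qed.

Lemma Lfun2_sgn (h : R -> R) : h \in Lfun haar_measure 2%:E ->
  (fun t => t / `|t| * h t) \in Lfun haar_measure 2%:E.
Proof.
move=> /Lfun2P[mh ih]; have mi := @measurable_haar_density R.
have ms : measurable_fun [set: measurableTypeR R] (fun t : R => t / `|t| * h t).
  by apply: measurable_funM => //; apply: measurable_funM => //; exact/measurable_EFinP.
apply/Lfun2P; split => //; apply: le_lt_trans ih; apply: ge0_le_integral => //.
- by move=> t _; rewrite lee_fin sqr_ge0.
- by apply/measurable_EFinP; exact: measurable_funX.
- by apply/measurable_EFinP; exact: measurable_funX.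
- move=> t _; rewrite lee_fin exprMn expr_div_n real_normK ?num_real//.
  have [->|t0] := eqVneq t 0; first by rewrite expr0n /= !mul0r sqr_ge0.
  by rewrite divff ?mul1r// sqrf_eq0.
Qed.

Lemma Lfun2_opp (h : R -> R) : h \in Lfun haar_measure 2%:E ->
  (fun t => h (- t)) \in Lfun haar_measure 2%:E.
Proof.
move=> /Lfun2P[mh ih]; apply/Lfun2P; split.
  by apply: measurableT_comp.
rewrite (haar_int_opp (h := fun t => (h t ^+ 2)%:E))//.
  by apply/measurable_EFinP; exact: measurable_funX.
by move=> t; rewrite lee_fin sqr_ge0.
Qed.

Fact Sop_subproof (f : L2fun haar_measure) :
  (fun t : R => (t / `|t|)%:C * f t) \in CLfun haar_measure 2%:E.
Proof.
have /andP[f1 f2] := L2funP f; apply/andP; split.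
  rewrite (_ : _ \o _ = fun t => t / `|t| * (Re \o f) t) ?Lfun2_sgn//.
  by apply/funext => t /=; case: (f t) => x y /=; rewrite mul0r subr0.
rewrite (_ : _ \o _ = fun t => t / `|t| * (Im \o f) t) ?Lfun2_sgn//.
by apply/funext => t /=; case: (f t) => x y /=; rewrite mul0r addr0.
Qed.

(* (S x)(t) = sgn(t) x(t) *)
Definition Sop (x : H) : H := \pi_(L2 haar_measure) (L2Fun (Sop_subproof (repr x))).

Lemma SopE (f : L2fun haar_measure) :
  Sop (\pi_(L2 haar_measure) f) = \pi_(L2 haar_measure) (L2Fun (Sop_subproof f)).
Proof. by apply/L2_eqP; apply: filterS (repr_piE f) => t /= ->. Qed.

Fact Rop_subproof (f : L2fun haar_measure) : (fun t : R => f (- t)) \in CLfun haar_measure 2%:E.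
Proof.
have /andP[f1 f2] := L2funP f; apply/andP.
by split; [exact: (Lfun2_opp f1)|exact: (Lfun2_opp f2)].
Qed.

(* (R x)(t) = x(-t) *)
Definition Rop (x : H) : H := \pi_(L2 haar_measure) (L2Fun (Rop_subproof (repr x))).

Lemma RopE (f : L2fun haar_measure) :
  Rop (\pi_(L2 haar_measure) f) = \pi_(L2 haar_measure) (L2Fun (Rop_subproof f)).
Proof.
apply/L2_eqP; have [N [mN N0 sN]] := repr_piE f.
exists (-%R @^-1` N); split; last by move=> t /= h; apply: sN.
  rewrite -[X in measurable X]setTI.
  have mo : measurable_fun setT (-%R : measurableTypeR R -> measurableTypeR R) by [].
  exact: mo.
exact: etrans (haarN mN) N0.
Qed.

End SR.

Section bounded_linear.
Context (R : realType) (V W : normedModType R[i]).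
Local Notation C := R[i].

Definition op_bound (f : V -> W) (M : R) :=
  0 <= M /\ forall x, rnorm (f x) <= M * rnorm x.

(* BL V W is the normed space of bounded linear maps from V to W. *)
Definition bounded_linear : {pred V -> W} := mem [set f : V -> W |
  linear f /\ exists M, op_bound f M].

Lemma op_boundD f g M N :
  op_bound f M -> op_bound g N -> op_bound (f + g) (M + N).
Proof.
move=> [M0 fM] [N0 gN]; split; first exact: addr_ge0.
by move=> x; rewrite mulrDl (le_trans (rnormD _ _))// lerD.
Qed.

Lemma op_boundZ (a : C) f M :
  op_bound f M -> op_bound (a *: f) (rnorm (a : C^o) * M).
Proof.
move=> [M0 fM]; split; first by rewrite mulr_ge0 ?rnorm_ge0.
by move=> x; rewrite -[(a *: f) x]/(a *: f x) rnormZ -mulrA ler_wpM2l ?rnorm_ge0.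
Qed.

Lemma op_bound0 : op_bound 0 0.
Proof. by split=> // x; rewrite mul0r -[(0 : V -> W) x]/(0 : W) rnorm0. Qed.

Lemma bounded_linear_submod : submod_closed bounded_linear.
Proof.
split.
  rewrite inE /=; split; last by exists 0; exact: op_bound0.
  by move=> a x y; rewrite -[LHS]/(0 : W) -[RHS]/(a *: 0 + 0 : W) scaler0 addr0.
move=> a f g; rewrite !inE /= => -[lf [M fM]] [lg [N gN]]; split; last first.
  by exists (rnorm (a : C^o) * M + N); apply: op_boundD => //; exact: op_boundZ.
move=> b x y; rewrite -[LHS]/(a *: f _ + g _) lf lg.
rewrite -[X in _ = b *: X + _]/(a *: f x + g x) -[X in _ = _ + X]/(a *: f y + g y).
by rewrite !scalerDr addrACA !scalerA mulrC.
Qed.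

HB.instance Definition _ :=
  GRing.isSubmodClosed.Build C (V -> W) bounded_linear bounded_linear_submod.

Record BL := BoundedLinear { BL_fun :> V -> W; BLP : BL_fun \in bounded_linear }.
HB.instance Definition _ := [isSub for BL_fun].
HB.instance Definition _ := [Choice of BL by <:].
HB.instance Definition _ := [SubChoice_isSubLmodule of BL by <:].

Fact BL_linear (f : BL) : linear f.
Proof. by have := BLP f; rewrite inE => -[]. Qed.
HB.instance Definition _ (f : BL) :=
  GRing.isLinear.Build C V W *:%R (BL_fun f) (BL_linear f).

Definition opnorm (f : BL) : R := inf [set M | op_bound f M].

Lemma has_inf_op_bound (f : BL) : has_inf [set M | op_bound f M].
Proof.
split; first by have := BLP f; rewrite inE => -[_ [M fM]]; exists M.
by exists 0 => M [].
Qed.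

Lemma opnorm_le (f : BL) M : op_bound f M -> opnorm f <= M.
Proof. by move=> fM; apply: ge_inf => //; have [] := has_inf_op_bound f. Qed.

Lemma opnorm_ge (f : BL) c : (forall M, op_bound f M -> c <= M) -> c <= opnorm f.
Proof. by move=> h; apply: lb_le_inf; [have [] := has_inf_op_bound f|]. Qed.

Lemma opnorm_bound (f : BL) : op_bound f (opnorm f).
Proof.
split=> [|x]; first by apply: opnorm_ge => M [].
have [x0|x0] := eqVneq (rnorm x) 0.
  by have [_ [M [_ /(_ x)]]] := set_mem (BLP f); rewrite x0 !mulr0.
have {}x0 : 0 < rnorm x by rewrite lt_def x0 rnorm_ge0.
rewrite -ler_pdivrMr//; apply: opnorm_ge => M [_ fM].
by rewrite ler_pdivrMr.
Qed.

Lemma opnormD (f g : BL) : opnorm (f + g) <= opnorm f + opnorm g.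
Proof. by apply: opnorm_le; apply: op_boundD; exact: opnorm_bound. Qed.

Lemma opnormZ_le a (f : BL) : opnorm (a *: f) <= rnorm (a : C^o) * opnorm f.
Proof. by apply: opnorm_le; apply: op_boundZ; exact: opnorm_bound. Qed.

Lemma opnormZ a (f : BL) : opnorm (a *: f) = rnorm (a : C^o) * opnorm f.
Proof.
apply/le_anti; rewrite opnormZ_le /=.
have [->|a0] := eqVneq a 0.
  by rewrite rnorm0 mul0r; apply: opnorm_ge => M [].
have n0 : 0 < rnorm (a : C^o).
  by rewrite lt_def rnorm_ge0 andbT; apply: contra a0 => /eqP/rnorm0_eq0 ->.
rewrite mulrC -ler_pdivlMr//; have := opnormZ_le a^-1 (a *: f).
rewrite scalerA mulVf// scale1r mulrC (_ : rnorm _ = (rnorm (a : C^o))^-1)//.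
by apply: complexI; rewrite fmorphV /= -!rnormE normfV.
Qed.

Lemma opnorm_eq0 (f : BL) : opnorm f = 0 -> f = 0.
Proof.
move=> f0; apply/val_inj/funext => x /=; apply: rnorm0_eq0.
have [_ /(_ x)] := opnorm_bound f; rewrite f0 mul0r => h.
by apply/le_anti; rewrite h rnorm_ge0.
Qed.

Definition BLnorm (f : BL) : C := (opnorm f)%:C.
Fact BLnormD f g : BLnorm (f + g) <= BLnorm f + BLnorm g.
Proof. by rewrite -rmorphD lecR opnormD. Qed.
Fact BLnormZ a f : BLnorm (a *: f) = `|a| * BLnorm f.
Proof. by rewrite /BLnorm opnormZ rmorphM -[`|a|]/(`|a : C^o|) rnormE. Qed.
Fact BLnorm_eq0 f : BLnorm f = 0 -> f = 0.
Proof. by move=> /complexI/opnorm_eq0. Qed.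

HB.instance Definition _ := Lmodule_isNormed.Build C BL BLnormD BLnormZ BLnorm_eq0.
End bounded_linear.

Section adjoint.
Context (R : realType).
Local Notation C := R[i].
Implicit Types V W U : normedModType C.

Definition dual V := BL V C^o.

Fact BL_comp_subproof U V W (g : BL V W) (f : BL U V) : g \o f \in @bounded_linear R U W.
Proof.
rewrite inE; split; first by move=> a x y; rewrite /= !linearP.
exists (opnorm g * opnorm f); split.
  by rewrite mulr_ge0; [by []| |]; have [] := opnorm_bound g; have [] := opnorm_bound f.
move=> x /=; have [g0 gM] := opnorm_bound g; have [f0 fM] := opnorm_bound f.
by rewrite (le_trans (gM _))// -mulrA ler_wpM2l.
Qed.
Definition BL_comp U V W (g : BL V W) (f : BL U V) : BL U W :=
  BoundedLinear (BL_comp_subproof g f).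

Fact adjoint_subproof V W (f : BL V W) :
  (fun phi : dual W => BL_comp phi f : dual V) \in @bounded_linear R (dual W) (dual V).
Proof.
rewrite inE; split; first by move=> a x y; exact/val_inj.
exists (opnorm f); have [f0 fM] := opnorm_bound f; split => // phi.
rewrite mulrC; apply: opnorm_le; have [g0 gM] := opnorm_bound phi.
split; first exact: mulr_ge0.
by move=> x; rewrite (le_trans (gM _))// -mulrA ler_wpM2l.
Qed.
(* The Banach space adjoint phi |-> phi o f. *)
Definition adjoint V W (f : BL V W) : BL (dual W) (dual V) :=
  BoundedLinear (adjoint_subproof f).
End adjoint.

Section completely_bounded.
Context d (T : measurableType d) (R : realType) (mu : {measure set T -> \bar R}).
Local Notation C := R[i].
Local Notation H := (L2 mu).
Local Notation S1 := (S1 mu).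

Definition ball2 (V : normedModType C) (I : finType) : set (I -> V) :=
  [set x | \sum_i rnorm (x i) ^+ 2 <= 1].

(* Matrices over C as operators on l^2(I): norm_MC M is the operator norm, as the
   supremum of |<M x, y>| over x and y in the unit ball. *)
Definition norm_MC (I : finType) (M : I -> I -> C) : \bar R :=
  ereal_sup [set r | exists x y : I -> C^o, [/\ ball2 x, ball2 y &
    r = (rnorm (\sum_i \sum_j M i j * x j * (y i)^* : C^o))%:E]].

(* The dual of S1 is B(H): phi corresponds to the operator b such that
   phi (x (x) y) = <b x, y>. For a matrix phi over the dual, norm_MBH phi is the norm
   of the corresponding matrix (b_ij) over B(H), acting on H^n: the supremum of
   |<b x, y>| = |\sum_ij <b_ij x_j, y_i>| over x and y in the unit ball of H^n. *)
Definition norm_MBH n (phi : 'M[dual S1]_n) : \bar R :=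
  ereal_sup [set r | exists x y : 'I_n -> H, [/\ ball2 x, ball2 y &
    r = (rnorm (\sum_i \sum_j phi i j (tensor (x j) (y i)) : C^o))%:E]].

(* The matrix norms of S1 as the operator space predual of B(H):
   |(A_ij)| is the supremum of |(phi_kl (A_ij))| over all m and all phi in the
   unit ball of M_m(B(H)). *)
Definition norm_MS1 n (A : 'M[S1]_n) : \bar R :=
  ereal_sup [set r | exists m (phi : 'M[dual S1]_m), (norm_MBH phi <= 1)%E /\
    r = norm_MC (fun p q : 'I_m * 'I_n => phi p.1 q.1 (A p.2 q.2))].

(* The amplifications M_n(S1) -> M_n(S1^* ) of Phi are uniformly bounded. *)
Definition completely_bounded (Phi : BL S1 (dual S1)) :=
  exists K : R, forall n (A : 'M[S1]_n),
    (norm_MBH (map_mx Phi A) <= K%:E * norm_MS1 A)%E.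
End completely_bounded.

Notation HRx R := (L2 (@haar_measure R)).
(* The operator space underlying the algebra: the product enters neither its dual nor
   complete boundedness. *)
Notation ARx R := (S1 (@haar_measure R)).
Notation "''[' u , v ]" := (L2inner u v) : ring_scope.

(* Main.v *)
Require Import Defs.
From mathcomp Require Import all_boot all_order all_algebra.
From mathcomp Require Import all_classical all_reals all_analysis.
From mathcomp.real_closed Require Import complex.
From mathcomp Require Import measurable_realfun ring lra.

Import GRing.Theory.
Local Open Scope ring_scope.

Import Order.TTheory Num.Def Num.Theory.
Import numFieldNormedType.Exports.
Local Open Scope classical_set_scope.
Set Implicit Arguments.
Unset Strict Implicit.
Unset Printing Implicit Defensive.

(** The operators S and R are contractions, S is self-adjoint and the pointwise
    conjugation is an involution, so composing D with the transpose gives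
      (top D)(u (x) v)(x (x) y) = <R x, v> <u, S R y>.
    Both sides are continuous in the trace-class operator A = u (x) v, and the
    elementary tensors span a dense subspace (dual_S1_ext); hence
    (top D)(A)(x (x) y) = <A R x, S R y> for every A. In other words, up to two
    contractions of H, the map top D is the inclusion of S_1(H) into B(H). Under
    the pairing of S_1(H) with B(H) that is used here, the bilinear form of this
    inclusion is <A x, y>, and as a functional on S_1(H (x) H) it is given by the
    flip of the two tensor factors, an operator of norm one. Hence top D is
    completely contractive (completely_bounded_flip).

    In terms of matrices, let (A_ij) be a matrix over S_1(H), and let a_j = R x_j
    and b_i = S R y_i with (x_j) and (y_i) in the unit ball of H^n. Gram-Schmidt
    yields systems (e_l) and (f_k), orthonormal up to zero vectors, with a_j in the
    span of the e_l and b_i in the span of the f_k. Then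
      \sum_ij <A_ij a_j, b_i>
        = \sum_ijkl <A_ij e_l, f_k> <a_j, e_l> conj <b_i, f_k>
    is the form of the scalar matrix (phi_kl (A_ij)), where phi_kl (A) = <A e_l, f_k>,
    at the vectors (<a_j, e_l>)_lj and (<b_i, f_k>)_ki. These are in the unit ball of
    l^2 by Bessel's inequality. The matrix (phi_kl) over B(H) consists of the rank one
    operators e_l (x) f_k; it is a corner of the flip and has norm at most one
    (norm_MBH_vector_functionals). So the sum is at most the norm of (A_ij) in
    M_n(S_1(H)). *)

(** * Gram-Schmidt orthonormalization and Bessel's inequality *)

Section dot_product.
Context (C : numClosedFieldType) (V : lmodType C) (form : {dot V for conjC}).
Local Notation "''[' u , v ]" := (form u v) : ring_scope.

(** The vectors are pairwise orthogonal and of norm one or zero. Allowing zero lets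
    Gram-Schmidt keep the index set of a linearly dependent family. *)
Definition semi_orthonormal (I : eqType) (e : I -> V) :=
  forall i j, '[e i, e j] = ((i == j) && (e i != 0))%:R.

Lemma dot_projection (I : finType) (e : I -> V) z i : semi_orthonormal e ->
  '[\sum_l '[z, e l] *: e l, e i] = '[z, e i].
Proof.
move=> oe; rewrite linear_sumlz (bigD1 i)//= big1 => [|l /negPf li]; last first.
  by rewrite linearZl_LR /= oe li mulr0.
rewrite addr0 linearZl_LR /= oe eqxx /=.
by have [->|_] := eqVneq (e i) 0; rewrite ?linear0r ?mul0r ?mulr1.
Qed.

Lemma dot_conj u v : '[u, v] = ('[v, u])^*.
Proof. by rewrite hermC expr0 mul1r. Qed.

(** The difference of z and its projection p is orthogonal to p, so <z - p, z - p> is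
    <z, z> minus the sum, and it is nonnegative. *)
Lemma bessel (I : finType) (e : I -> V) z : semi_orthonormal e ->
  \sum_i `|'[z, e i]| ^+ 2 <= '[z, z].
Proof.
move=> oe; set p := \sum_i '[z, e i] *: e i.
have ow i : '[e i, z - p] = 0.
  by rewrite dot_conj linearBl /= dot_projection// subrr conjC0.
have := dnorm_ge0 form (z - p).
rewrite {1}linearBl /= [X in _ - X]linear_sumlz big1 => [|i _]; last first.
  by rewrite linearZl_LR /= ow mulr0.
rewrite subr0 linearBr /= linear_sumr subr_ge0 /=.
by under eq_bigr do rewrite linearZr_LR /= mulrC -normCK.
Qed.

(** The induction adds the normalization g of x_n - p, where p is the projection of
    x_n onto the vectors found so far. The system is indexed by all naturals and
    padded with zeros, which frees the orthogonality relations of range conditions. *)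
Lemma gram_schmidt_nat n (x : nat -> V) : exists2 e : nat -> V, semi_orthonormal e &
  (forall l, (n <= l)%N -> e l = 0) /\
  forall j, (j < n)%N -> x j = \sum_(l < n) '[x j, e l] *: e l.
Proof.
elim: n => [|n [e oe [e0 xe]]].
  by exists (fun=> 0) => // i j; rewrite linear0l eqxx andbF.
set p := \sum_(l < n) '[x n, e l] *: e l; pose w := x n - p.
pose c := sqrtC '[w, w]; pose g := c^-1 *: w.
have oeI : semi_orthonormal (fun l : 'I_n => e l).
  by move=> i j; rewrite oe; congr ((_ && _)%:R).
have ow l : '[w, e l] = 0.
  have [ln|nl] := ltnP l n; last by rewrite e0// linear0r.
  by rewrite linearBl /= (dot_projection _ (Ordinal ln) oeI) subrr.
have oge l : '[g, e l] = 0 by rewrite linearZl_LR /= ow mulr0.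
have cr : c^* = c by apply: CrealP; rewrite ger0_real// sqrt_dnorm_ge0.
(* If w = 0 then c^-1 = 0 and g = 0, in agreement with the right-hand side. *)
have gg : '[g, g] = (g != 0)%:R.
  rewrite linearZl_LR linearZr_LR /= fmorphV /= cr -(sqrtCK '[w, w]) -/c expr2.
  rewrite /g scaler_eq0 invr_eq0; have [->|c0] /= := eqVneq c 0.
    by rewrite invr0 !mul0r.
  rewrite mulKf// mulVf//; have -> // : w != 0.
  by apply: contra c0 => /eqP w0; rewrite /c w0 linear0l sqrtC0.
have xg : '[x n, g] *: g = w.
  rewrite -[x n](subrK p) -/w linearDl /= [X in _ + X]dot_conj linear_sumr big1 ?conjC0.
    rewrite addr0 linearZr_LR /= fmorphV /= cr -(sqrtCK '[w, w]) -/c /g scalerA expr2.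
    have [c0|c0] := eqVneq c 0; last by rewrite mulKf// divff// scale1r.
    have -> : w = 0 by apply/eqP; rewrite -(sqrt_dnorm_eq0 form) -/c c0.
    by rewrite scaler0.
  by move=> l _; rewrite linearZr_LR /= oge mulr0.
exists (fun l => if l == n then g else e l).
  move=> i j /=; have [->|i_n] := eqVneq i n; have [jn|j_n] := eqVneq j n.
  - by rewrite gg.
  - by rewrite oge.
  - by rewrite dot_conj oge conjC0 jn (negPf i_n).
  - exact: oe.
split=> [l nl|j].
  by rewrite gtn_eqF// e0// ltnW.
have lt_eq (l : 'I_n) : (val l == n) = false by rewrite ltn_eqF ?ltn_ord.
rewrite big_ord_recr /= eqxx ltnS leq_eqVlt => j_n.
under eq_bigr do rewrite lt_eq.
have [->|jn] := eqVneq j n; first by rewrite xg addrC subrK.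
have {}jn : (j < n)%N by rewrite ltn_neqAle jn -ltnS ltnS leq_eqVlt.
rewrite -xe// {3}(xe j jn) linear_sumlz big1 ?scale0r ?addr0// => l _.
by rewrite linearZl_LR /= [X in _ * X]dot_conj oge conjC0 mulr0.
Qed.

Lemma gram_schmidt n (x : 'I_n -> V) : exists2 e : 'I_n -> V, semi_orthonormal e &
  forall j, x j = \sum_l '[x j, e l] *: e l.
Proof.
have [e oe [_ xe]] := gram_schmidt_nat n (fun k => oapp x 0 (insub k)).
exists (fun l => e l) => [i j|j]; first by rewrite oe.
by have := xe _ (ltn_ord j); rewrite valK.
Qed.
End dot_product.

Local Open Scope complex_scope.

(** * Functionals on the trace-class operators *)

Section trace_class_functionals.
Context d (T : measurableType d) (R : realType) (mu : {measure set T -> \bar R}).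
Local Notation C := R[i].
Local Notation H := (L2 mu).
Local Notation S1 := (S1 mu).
Local Notation dotL2 := (@L2inner d T R mu : {dot H for conjC}).
Implicit Types (A : S1) (a b u v x y : H).

Lemma rnorm_L2inner x y : rnorm ('[x, y] : C^o) <= rnorm x * rnorm y.
Proof.
by rewrite -lecR rmorphM /= -!rnormE; exact: L2CauchySchwarz.
Qed.

Lemma rnorm_sqr x : (rnorm x ^+ 2)%:C = '[x, x].
Proof. by rewrite rmorphXn /= -rnormE; exact: L2normK. Qed.

Lemma rnorm_trace A : rnorm A = trace_norm A.
Proof. by []. Qed.

Lemma rnorm_S1_apply A x : rnorm (A x) <= rnorm A * rnorm x.
Proof.
rewrite rnorm_trace; have [x0|x0] := eqVneq (rnorm x) 0.
  by have /nuclearP[s /(nuclear_rep_bound x)] := S1P A; rewrite x0 !mulr0.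
have {}x0 : 0 < rnorm x by rewrite lt_def x0 rnorm_ge0.
rewrite -ler_pdivrMr//; apply: trace_norm_ge => s r.
by rewrite ler_pdivrMr//; exact: nuclear_rep_bound.
Qed.

Fact vector_functional_subproof a b :
  (fun A : S1 => '[A a, b] : C^o) \in @bounded_linear R S1 C^o.
Proof.
rewrite inE; split=> [c A B|]; first by rewrite (linearDl dotL2) (linearZl_LR dotL2).
exists (rnorm a * rnorm b); split=> [|A]; first by rewrite mulr_ge0 ?rnorm_ge0.
rewrite (le_trans (rnorm_L2inner _ _))// mulrAC ler_wpM2r ?rnorm_ge0//.
by rewrite mulrC rnorm_S1_apply.
Qed.
Definition vector_functional a b : dual S1 := BoundedLinear (vector_functional_subproof a b).

Lemma vector_functional_tensor a b u v :
  vector_functional a b (tensor u v) = '[a, v] * '[u, b].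
Proof. by rewrite /= (linearZl_LR dotL2). Qed.

Lemma S1_sumE n (F : nat -> S1) x :
  (\sum_(0 <= k < n) F k : S1) x = \sum_(0 <= k < n) F k x.
Proof. exact: (big_morph (fun B : S1 => B x) (fun A B => erefl) erefl). Qed.

(** In a nuclear decomposition of A of finite cost s, the tails decompose the
    remainders of A, and they cost s minus a partial sum of the costs. *)
Lemma tensor_approx A (e : R) : 0 < e -> exists n (u v : nat -> H),
  rnorm (A - \sum_(0 <= k < n) tensor (u k) (v k)) <= e.
Proof.
move=> e0; have /nuclearP[s [u [v [uvA cost]]]] := S1P A.
have [n hn] : exists n, s - e < \sum_(0 <= k < n) rnorm (u k) * rnorm (v k).
  apply: contrapT => /forallNP h.
  suff : (nuclear_cost u v <= (s - e)%:E)%E.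
    by rewrite cost lee_fin lerBrDr gerDl leNgt e0.
  by apply: cost_ub => n; rewrite leNgt; apply/negP.
exists n, u, v; rewrite rnorm_trace.
have [||t te r] := @nuclear_repP _ _ _ mu (fun k => u (k + n)%N) (fun k => v (k + n)%N)
    (A - \sum_(0 <= k < n) tensor (u k) (v k)) e; last first.
- exact: le_trans (trace_norm_le r) te.
- apply: cost_ub => m.
  have := cost_lb u v (n + m); rewrite cost lee_fin.
  rewrite (big_cat_nat (n := n)) ?leq_addr//= -lerBrDl => h.
  rewrite -{1}[n]add0n big_addn addnC addnK in h.
  by apply: (le_trans h); rewrite lerBlDl -lerBlDr ltW.
- move=> x; rewrite -[X in _ --> X]/(A x - (\sum_(0 <= k < n) tensor (u k) (v k) : S1) x).
  rewrite S1_sumE.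
  rewrite (_ : series _ = fun m => series (fun k => '[x, v k] *: u k) (m + n)%N -
      \sum_(0 <= k < n) '[x, v k] *: u k).
    apply: cvgB; last exact: cvg_cst.
    by rewrite cvg_shiftn; exact: uvA.
  apply/funext => m; rewrite /series /= [X in _ = X - _](big_cat_nat (n := n)) ?leq_addl//=.
  by rewrite addrAC subrr add0r -{3}[n]add0n big_addn addnK.
Qed.

(** The finite sums of elementary tensors are dense for the trace norm. *)
Lemma dual_S1_ext (phi psi : dual S1) :
  (forall u v, phi (tensor u v) = psi (tensor u v)) -> phi = psi.
Proof.
move=> h; apply/subr0_eq/val_inj/funext => A.
have [M0 hM] := opnorm_bound (phi - psi).
apply: (@rnorm0_eq0 _ C^o); apply/le_anti; rewrite rnorm_ge0 andbT.
apply/ler_addgt0Pl => e e0; rewrite addr0.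
have M1 : 0 < opnorm (phi - psi) + 1 by rewrite ltr_pwDr.
have [n [u [v uv]]] := tensor_approx A (divr_gt0 e0 M1).
rewrite -[X in rnorm X]/((phi - psi) A).
have -> : (phi - psi) A =
    (phi - psi) (A - \sum_(0 <= k < n) tensor (u k) (v k)).
  rewrite linearB linear_sum /= big1 ?subr0// => k _.
  by rewrite -[LHS]/(phi _ - psi _) h subrr.
apply: (le_trans (hM _)).
apply: (@le_trans _ _ ((opnorm (phi - psi) + 1) * (e / (opnorm (phi - psi) + 1)))).
  by rewrite ler_pM ?rnorm_ge0// lerDl.
by rewrite mulrC divfK// gt_eqF.
Qed.
End trace_class_functionals.

(** * Complete boundedness of the flip *)

Section flip.
Context d (T : measurableType d) (R : realType) (mu : {measure set T -> \bar R}).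
Local Notation C := R[i].
Local Notation H := (L2 mu).
Local Notation S1 := (S1 mu).
Local Notation dotL2 := (@L2inner d T R mu : {dot H for conjC}).
Implicit Types (A : S1) (a b u v x y : H).

Fact evaluation_subproof (V : normedModType C) (t : V) :
  (fun phi : dual V => phi t) \in @bounded_linear R (dual V) C^o.
Proof.
rewrite inE; split=> //; exists (rnorm t); split=> [|phi]; first exact: rnorm_ge0.
by have [_ /(_ t)] := opnorm_bound phi; rewrite mulrC.
Qed.
Definition evaluation (V : normedModType C) (t : V) : BL (dual V) C^o :=
  BoundedLinear (evaluation_subproof t).

Lemma sum_dualE n (F : 'I_n -> dual S1) A : (\sum_i F i : dual S1) A = \sum_i F i A.
Proof. exact: (big_morph (fun phi : dual S1 => phi A) (fun _ _ => erefl) erefl). Qed.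

Lemma vector_functional_expand n (e f : 'I_n -> H) a b :
  a = \sum_l '[a, e l] *: e l -> b = \sum_k '[b, f k] *: f k ->
  vector_functional a b = \sum_k \sum_l
    ('[a, e l] * ('[b, f k])^*) *: vector_functional (e l) (f k).
Proof.
move=> ae bf; apply: dual_S1_ext => u v.
rewrite vector_functional_tensor {1}ae {1}bf sum_dualE.
rewrite (linear_sumlz dotL2) (linear_sumr dotL2) mulr_sumr; apply: eq_bigr => k _.
rewrite sum_dualE mulr_suml; apply: eq_bigr => l _.
rewrite -[RHS]/(_ * vector_functional (e l) (f k) (tensor u v)) vector_functional_tensor.
by rewrite (linearZl_LR dotL2) (linearZr_LR dotL2) /= mulrACA.
Qed.

Lemma sum_pair (V : nmodType) (I J : finType) (F : I * J -> V) :
  \sum_p F p = \sum_i \sum_j F (i, j).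
Proof. by rewrite pair_bigA; apply: eq_bigr => -[]. Qed.

(** Bessel's inequality for each z_j: the coefficients form a vector of the unit ball
    of l^2. *)
Lemma sum_norm_L2inner_le1 (I : finType) n (e : I -> H) (z : 'I_n -> H) :
  semi_orthonormal dotL2 e -> ball2 z ->
  \sum_i \sum_j rnorm ('[z j, e i] : C^o) ^+ 2 <= 1.
Proof.
move=> oe; apply: le_trans; rewrite exchange_big /= ler_sum// => j _.
rewrite -lecR rnorm_sqr rmorph_sum /= (le_trans _ (bessel (z j) oe))//.
by apply: ler_sum => i _; rewrite rmorphXn /= -rnormE.
Qed.

(** The form of this matrix is \sum_kl <e_l, y_k> <x_l, f_k>. By the inequality between
    arithmetic and geometric means it is at most half the sum of the squares of the
    <y_k, e_l> and of the <x_l, f_k>, and both are controlled by Bessel. *)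
Lemma norm_MBH_vector_functionals n (e f : 'I_n -> H) :
  semi_orthonormal dotL2 e -> semi_orthonormal dotL2 f ->
  (norm_MBH (\matrix_(k, l) vector_functional (e l) (f k)) <= 1)%E.
Proof.
move=> oe fo; apply: ge_ereal_sup => _ [x [y [bx b_y ->]]]; rewrite lee_fin.
have rnorm_sum (I : finType) (F : I -> C^o) : rnorm (\sum_i F i) <= \sum_i rnorm (F i).
  rewrite -lecR rmorph_sum /= -rnormE.
  by under [leRHS]eq_bigr do rewrite -rnormE; exact: ler_norm_sum.
have rnormM (r s : C^o) : rnorm (r * s : C^o) = rnorm r * rnorm s by rewrite -rnormZ.
have rnorm_sym u v : rnorm ('[u, v] : C^o) = rnorm ('[v, u] : C^o).
  by apply: complexI; rewrite -!rnormE (dot_conj dotL2) /= norm_conjC.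
apply: (@le_trans _ _ (\sum_k \sum_l (2^-1 * rnorm ('[x l, f k] : C^o) ^+ 2 +
    2^-1 * rnorm ('[y k, e l] : C^o) ^+ 2))).
  apply: (le_trans (rnorm_sum _ _)); apply: ler_sum => k _.
  apply: (le_trans (rnorm_sum _ _)); apply: ler_sum => l _.
  rewrite mxE vector_functional_tensor rnormM (rnorm_sym (e l)).
  by have := sqr_ge0 (rnorm ('[x l, f k] : C^o) - rnorm ('[y k, e l] : C^o)); lra.
under eq_bigr do rewrite big_split /= -!mulr_sumr.
rewrite big_split /= -!mulr_sumr [X in _ + _ * X]exchange_big /=.
have := sum_norm_L2inner_le1 fo bx; have := sum_norm_L2inner_le1 oe b_y; lra.
Qed.

(** Phi sends an operator A to the form (x, y) |-> <A (alpha x), beta y>. The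
    matrix norm of (A_ij) is bounded below by testing it on the functionals given by
    Gram-Schmidt systems of the alpha x_j and of the beta y_i. *)
Lemma completely_bounded_flip (Phi : BL S1 (dual S1)) (alpha beta : H -> H) :
  (forall x, rnorm (alpha x) <= rnorm x) -> (forall y, rnorm (beta y) <= rnorm y) ->
  (forall u v x y, Phi (tensor u v) (tensor x y) = '[alpha x, v] * '[u, beta y]) ->
  completely_bounded Phi.
Proof.
move=> alpha1 beta1 PhiE.
have {}PhiE A x y : Phi A (tensor x y) = vector_functional (alpha x) (beta y) A.
  suff -> : vector_functional (alpha x) (beta y) = BL_comp (evaluation (tensor x y)) Phi by [].
  by apply: dual_S1_ext => u v; rewrite vector_functional_tensor -PhiE.
have ball_contraction n (g : H -> H) (z : 'I_n -> H) :
    (forall w, rnorm (g w) <= rnorm w) -> ball2 z -> ball2 (g \o z).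
  move=> g1; apply: le_trans; apply: ler_sum => i _.
  by rewrite ler_sqr ?nnegrE ?rnorm_ge0// g1.
exists 1 => n A; rewrite mul1e; apply: ge_ereal_sup => _ [x [y [bx b_y ->]]].
have [e oe xe] := gram_schmidt dotL2 (fun j => alpha (x j)).
have [f fo yf] := gram_schmidt dotL2 (fun i => beta (y i)).
pose phi := \matrix_(k, l) vector_functional (e l) (f k).
pose M (p q : 'I_n * 'I_n) := phi p.1 q.1 (A p.2 q.2).
apply: (@le_trans _ _ (norm_MC M)); last first.
  by apply: ereal_sup_ubound; exists n, phi; split => //; exact: norm_MBH_vector_functionals.
pose X (q : 'I_n * 'I_n) : C^o := '[alpha (x q.2), e q.1].
pose Y (p : 'I_n * 'I_n) : C^o := '[beta (y p.2), f p.1].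
apply: ereal_sup_ubound; exists X, Y; split.
- rewrite /ball2 /= sum_pair.
  exact: (sum_norm_L2inner_le1 oe (ball_contraction _ _ _ alpha1 bx)).
- rewrite /ball2 /= sum_pair.
  exact: (sum_norm_L2inner_le1 fo (ball_contraction _ _ _ beta1 b_y)).
congr (rnorm _)%:E; rewrite sum_pair [RHS]exchange_big /=.
apply: eq_bigr => i _.
under [RHS]eq_bigr => k _ do rewrite sum_pair exchange_big /=.
rewrite [RHS]exchange_big /=; apply: eq_bigr => j _.
rewrite mxE PhiE (vector_functional_expand (xe j : alpha (x j) = _) (yf i : beta (y i) = _)).
rewrite sum_dualE; apply: eq_bigr => k _; rewrite sum_dualE; apply: eq_bigr => l _.
by rewrite /M /phi mxE -mulrA [RHS]mulrC.
Qed.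
End flip.

(** * The operators S and R *)

Lemma L2conjK d (T : measurableType d) (R : realType) (mu : {measure set T -> \bar R}) :
  involutive (@L2conj d T R mu).
Proof.
elim/quotW => f; rewrite (L2conjE f) (L2conjE (L2Fun (L2conj_subproof f))).
by apply/L2_eqP/aeW => t; exact: conjCK.
Qed.

Section operators.
Context (R : realType).
Local Notation mu := (@haar_measure R).
Local Notation H := (L2 mu).
Implicit Types x y : H.

Lemma rnorm_L2_eq x y : '[x, x] = '[y, y] -> rnorm x = rnorm y.
Proof. by rewrite -!rnorm_sqr => /complexI/eqP; rewrite eqrXn2 ?rnorm_ge0// => /eqP. Qed.

Lemma Sop_self_adjoint x y : '[Sop x, y] = '[x, Sop y].
Proof.
elim/quotW: x => f; elim/quotW: y => g; rewrite !SopE !L2innerE.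
congr Cintegral; apply/funext => t /=.
by case: (f t) (g t) => a b [c e]; simpc; congr (_ +i* _); ring.
Qed.

(** sgn(t)^2 = 1 except at t = 0, and {0} is a null set. *)
Lemma SopK : involutive (@Sop R).
Proof.
elim/quotW => f; rewrite (SopE f) (SopE (L2Fun (Sop_subproof f))).
apply/L2_eqP; exists [set 0]; split => //; first exact: integral_set1.
move=> t /=; apply: contra_notP => /eqP t0.
have sgn2 : t / `|t| * (t / `|t|) = 1.
  by rewrite mulf_div -expr2 -normrM -expr2 ger0_norm ?sqr_ge0// divff ?sqrf_eq0.
by rewrite mulrA -rmorphM /= sgn2 mul1r.
Qed.

Lemma rnorm_Sop x : rnorm (Sop x) = rnorm x.
Proof. by apply: rnorm_L2_eq; rewrite Sop_self_adjoint SopK. Qed.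

(** The Haar measure is invariant under t |-> - t. *)
Lemma rnorm_Rop x : rnorm (Rop x) = rnorm x.
Proof.
apply: rnorm_L2_eq; elim/quotW: x => f; rewrite RopE !L2innerE.
pose h t := complex.Re (f t * (f t)^*).
have [mh _] := measurable_CLfun (CLfun_mulC f f).
rewrite /Cintegral; congr (_ +i* _).
  congr fine; rewrite -(haar_int_opp (h := EFin \o h))//.
    exact/measurable_EFinP.
  by move=> t; rewrite lee_fin /h; case: (f t) => a b /=; rewrite mulrN opprK addr_ge0// -expr2 sqr_ge0.
have im0 (z : R[i]) : complex.Im (z * z^*) = 0 by case: z => a b /=; rewrite mulrN mulrC addNr.
by apply: eq_Rintegral => t _; rewrite !im0.
Qed.
End operators.

Theorem mainTheorem6 (R : realType)
  (D : BL (ARx R) (dual (ARx R)))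
  (hD : forall x1 y1 x0 y0 : HRx R,
    D (tensor x1 y1) (tensor x0 y0) =
      '[Sop x1, Rop (L2conj x0)] * '[Rop (L2conj y0), y1])
  (top_ : BL (ARx R) (ARx R))
  (htop_isometry : forall A : ARx R, `|top_ A| = `|A|)
  (htop : forall x y : HRx R,
    top_ (tensor x y) = tensor (L2conj y) (L2conj x)) :
  completely_bounded (BL_comp (adjoint top_) D).
Proof.
apply: (@completely_bounded_flip _ _ _ _ _ (@Rop R) (fun y => Sop (Rop y))) => [x|y|u v x y].
- by rewrite rnorm_Rop.
- by rewrite rnorm_Sop rnorm_Rop.
rewrite -[LHS]/(D (tensor u v) (top_ (tensor x y))) htop hD !L2conjK.
by rewrite Sop_self_adjoint mulrC.
Qed.
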